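(* Let $M$ be a loopless matroid of rank $r$ on $E$ and let $l=\sum_Fl_Fx_F\in A^1(M)$ be a degree-$1$ class. Consider the following properties of $l$: (P1) $l$ is the pullback of a nef divisor on $X_E$; i.e. there exists $\tilde l\in A^1(X_E)$ with $\tilde l$ nef and $i_M^*(\tilde l)=l$. (P2) For every flag $\mathcal{F}=(F_1\subsetneq\cdots\subsetneq F_k)$ of proper flats (including the empty flag) there is an expression $l=\sum_Fc_Fx_F$ with rational coefficients such that $c_{F_i}=0$ for all $i$ and $c_F\ge0$ for every proper flat $F$. (P3) For every flag $\mathcal{F}=(F_1\subsetneq\cdots\subsetneq F_k)$ of proper flats (including the empty flag) there is an expression $l=\sum_Fc_Fx_F$ with rational coefficients such that $c_{F_i}=0$ for all $i$ and $c_F\ge0$ for every proper flat $F$ with the property that $\mathcal{F}\sqcup\{F\}$ is again a flag. Then (P1) $\implies$ (P2) $\implies$ (P3), and both implications are strict (i.e. neither converse holds for all $M$ and $l$).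
   Context: All matroids are loopless. ''Proper flat'' means a flat $F$ with $\varnothing\ne F\ne E$. For a matroid $M$ on $E$, $X_M$ is the smooth toric variety of the Bergman fan of $M$, the fan in $\mathbb{R}^E/\mathbb{R}(1,\dots,1)$ whose cones are generated by $\{e_F:F\in\mathcal{F}\}$, $e_F=\sum_{i\in F}e_i$, for flags $\mathcal{F}$ (chains, possibly empty) of proper flats. $X_E$ is the permutohedral variety, i.e. $X_{U_n}$ for the Boolean matroid $U_n$ on $E$, $n=|E|$ (every subset is a flat); it is a smooth projective toric variety and ''nef'' on it has the usual meaning. $i_M:X_M\hookrightarrow X_E$ is the open inclusion. $A^*(M)=A^*(X_M)=\mathbb{Z}[x_F:F\text{ proper flat}]/(I+J)$, with $I$ generated by $x_Fx_G$ for incomparable $F,G$ and $J$ by $\sum_{F\ni i}x_F-\sum_{F\ni j}x_F$ ($i,j\in E$). The map $i_M^*$ sends $x_S$ to $x_S$ if $S$ is a flat of $M$ and to $0$ otherwise. Expressions $l=\sum_Fc_Fx_F$ are equalities in $A^1(M)_\mathbb{Q}$. *)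

(* Defs.v *)
From mathcomp Require Import all_boot all_order all_algebra.
From mathcomp Require Import mpoly.
From Stdlib Require List.

Set Implicit Arguments.
Unset Strict Implicit.
Unset Printing Implicit Defensive.

Import Order.TTheory GRing.Theory Num.Theory.
Local Open Scope ring_scope.

(** * Matroids *)

Record matroid (E : finType) := Matroid {
  indep : {set {set E}};
  indep0 : set0 \in indep;
  indepS : forall A B : {set E}, A \subset B -> B \in indep -> A \in indep;
  indepX : forall A B : {set E}, A \in indep -> B \in indep ->
    (#|A| < #|B|)%N -> exists2 x, x \in B :\: A & x |: A \in indep }.

Definition loopless (E : finType) (M : matroid E) : Prop :=
  forall x : E, [set x] \in indep M.

Definition rank (E : finType) (M : matroid E) (A : {set E}) : nat :=
  \max_(B in indep M | B \subset A) #|B|.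

Definition flat (E : finType) (M : matroid E) (F : {set E}) : bool :=
  [forall x in ~: F, (rank M F < rank M (x |: F))%N].

Definition proper_flat (E : finType) (M : matroid E) (F : {set E}) : bool :=
  [&& flat M F, F != set0 & F != [set: E]].

Definition pflat (E : finType) (M : matroid E) : finType :=
  {F : {set E} | proper_flat M F}.

Program Definition boolean_matroid (E : finType) : matroid E :=
  @Matroid E [set: {set E}] _ _ _.
Next Obligation. by rewrite inE. Qed.
Next Obligation. by rewrite inE. Qed.
Next Obligation.
have /subsetPn[x xB xA] : ~~ (B \subset A).
  by apply: contraL H1 => /subset_leq_card; rewrite leqNgt.
by exists x; rewrite ?inE ?xA.
Qed.

(** A flag is a (possibly empty) chain of proper flats. *)
Definition is_flag (E : finType) (M : matroid E) (Fl : {set pflat M}) : bool :=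
  [forall F in Fl, forall G in Fl,
     (val F \subset val G) || (val G \subset val F)].

(** * The Chow ring, as [R[x_F : F proper flat]] modulo the ideal [I + J] *)

Section Chow.
Variables (E : finType) (M : matroid E) (R : comNzRingType).

Definition chow_poly := {mpoly R[#|{: pflat M}|]}.

Definition chow_var (F : pflat M) : chow_poly := 'X_(enum_rank F).

Definition chow_genI (p : chow_poly) : Prop :=
  exists F G : pflat M,
    [/\ ~~ (val F \subset val G), ~~ (val G \subset val F)
      & p = chow_var F * chow_var G].

Definition chow_genJ (p : chow_poly) : Prop :=
  exists i j : E,
    p = \sum_(F : pflat M | i \in val F) chow_var F
        - \sum_(F : pflat M | j \in val F) chow_var F.

Definition chow_ideal (p : chow_poly) : Prop :=
  exists s : seq (chow_poly * chow_poly),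
    (forall ag, ag \in s -> chow_genI ag.2 \/ chow_genJ ag.2)
    /\ p = \sum_(ag <- s) ag.1 * ag.2.

(** Equality of classes in [A^*(M) ⊗ R]. *)
Definition chow_eq (p q : chow_poly) : Prop := chow_ideal (p - q).

Definition deg1 (c : pflat M -> R) : chow_poly := \sum_F c F *: chow_var F.

End Chow.

(** [i_M^*], on polynomial representatives. *)
Definition pullback (E : finType) (M : matroid E)
    (p : chow_poly (boolean_matroid E) int) : chow_poly M int :=
  p \mPo [tuple (if insub (val (enum_val i)) is Some F
                 then chow_var int (F : pflat M) else 0)
         | i < #|{: pflat (boolean_matroid E)}|].

(** * Complete curves

    A smooth projective curve over the algebraically closed field [k] is given
    by its function field [K], a finite extension of a rational function field
    [k(t)]; its closed points are the places of [K] over [k]. *)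

Record curve (k : closedFieldType) := Curve {
  curve_field :> fieldType;
  curve_const : {rmorphism k -> curve_field};
  curveP : exists t : curve_field,
    (forall p : {poly k}, p != 0 -> (map_poly curve_const p).[t] != 0) /\
    exists (n : nat) (b : 'I_n -> curve_field), forall y : curve_field,
      exists (q : {poly k}) (p : 'I_n -> {poly k}), q != 0 /\
        (map_poly curve_const q).[t] * y
        = \sum_i (map_poly curve_const (p i)).[t] * b i }.

(** Normalized discrete valuations of [C] trivial on [k]; the value at [0],
    morally [+oo], is fixed to the junk value [0] so that a place is determined
    by its valuation. *)
Record place (k : closedFieldType) (C : curve k) := Place {
  ord :> C -> int;
  ord0 : ord 0 = 0;
  ordM : forall x y : C, x != 0 -> y != 0 -> ord (x * y) = ord x + ord y;
  ordD : forall x y : C, x != 0 -> y != 0 -> x + y != 0 ->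
    Num.min (ord x) (ord y) <= ord (x + y);
  ord_const : forall c : k, ord (curve_const C c) = 0;
  ord_onto : exists2 x : C, x != 0 & ord x = 1 }.

Record divisor (k : closedFieldType) (C : curve k) := Divisor {
  mult :> place C -> int;
  supp : seq (place C);
  supp_uniq : List.NoDup supp;
  supp_mult : forall v, mult v <> 0 -> List.In v supp }.

(** All places have degree [1], as [k] is algebraically closed. *)
Definition div_deg (k : closedFieldType) (C : curve k) (D : divisor C) : int :=
  \sum_(v <- supp D) D v.

Definition principal (k : closedFieldType) (C : curve k)
    (D : place C -> int) : Prop :=
  exists2 f : C, f != 0 & forall v, D v = v f.

(** * Morphisms from a smooth projective curve to [X_M]

    The description of morphisms to a smooth toric variety by homogeneous
    coordinates (D. Cox, "The functor of a smooth toric variety"): for each ray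
    [e_F] a line bundle [L_F = O(D_F)] with a section [u_F], such that
    - the bundle [\bigotimes_F L_F^<m, e_F>] is trivial for all [m] in the dual
      lattice, which is generated by the [e_i^* - e_j^*];
    - at each point the rays whose coordinate vanishes span a cone of the fan.
    Here [O(D_F)] has as global sections [0] and the [f] with
    [v f + D_F v >= 0] for all [v], this integer being the order of vanishing
    of the section [f] at [v]. The choice of trivializations does not matter for
    the degrees below. The divisor [x_F] pulls back to [L_F]. *)
Record curve_map (k : closedFieldType) (C : curve k)
    (E : finType) (M : matroid E) := CurveMap {
  bundle : pflat M -> divisor C;
  sect : pflat M -> C;
  sectP : forall F v, sect F != 0 -> 0 <= ord v (sect F) + bundle F v;
  bundleP : forall i j : E, principal (fun v : place C =>
    \sum_(F : pflat M | i \in val F) bundle F v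
    - \sum_(F : pflat M | j \in val F) bundle F v);
  coneP : forall v : place C, exists Fl : {set pflat M}, is_flag Fl /\
    forall F, sect F = 0 \/ 0 < ord v (sect F) + bundle F v -> F \in Fl }.

(** The degree on the curve of the pullback of the divisor [\sum_F c_F x_F]. *)
Definition intersection_number (k : closedFieldType) (C : curve k)
    (E : finType) (M : matroid E) (f : curve_map C M) (c : pflat M -> int) :=
  \sum_F c F * div_deg (bundle f F).

(** Nonnegative degree on every complete curve; it is equivalent to let the
    curve range over all maps from smooth projective curves or only over the
    normalizations of the irreducible curves in the variety. *)
Definition nef (k : closedFieldType) (E : finType) (M : matroid E)
    (c : pflat M -> int) : Prop :=
  forall (C : curve k) (f : curve_map C M), 0 <= intersection_number f c.

(** * The three properties of the class [\sum_F l_F x_F] *)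

Definition P1 (k : closedFieldType) (E : finType) (M : matroid E)
    (l : pflat M -> int) : Prop :=
  exists lt : pflat (boolean_matroid E) -> int,
    nef k lt /\ chow_eq (pullback M (deg1 lt)) (deg1 l).

Definition expression (E : finType) (M : matroid E)
    (l : pflat M -> int) (c : pflat M -> rat) : Prop :=
  chow_eq (deg1 (fun F => (l F)%:~R)) (deg1 c).

Definition P2 (E : finType) (M : matroid E) (l : pflat M -> int) : Prop :=
  forall Fl : {set pflat M}, is_flag Fl ->
    exists c : pflat M -> rat,
      [/\ expression l c, forall F, F \in Fl -> c F = 0 & forall F, 0 <= c F].

Definition P3 (E : finType) (M : matroid E) (l : pflat M -> int) : Prop :=
  forall Fl : {set pflat M}, is_flag Fl ->
    exists c : pflat M -> rat,
      [/\ expression l c, forall F, F \in Fl -> c F = 0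
        & forall F, F \notin Fl -> is_flag (F |: Fl) -> 0 <= c F].

(* Main.v *)
Require Import Defs.
From mathcomp Require Import all_boot all_order all_algebra generic_quotient.
From mathcomp Require Import mpoly ring lra zify.
From Stdlib Require List.
From Stdlib Require Import FunctionalExtensionality ProofIrrelevance.

(** A divisor [\sum_F l_F x_F] is a function [l] on proper flats, and two divisors
    are linearly equivalent iff they differ by [F |-> \sum_(i in F) m_i] for a
    vector [m] with sum zero ([chow_eq_deg1P]). So (P2) asks, for each flag, for
    such a linear function that is at most [l] and tight on the flag ([P2P]), and
    (P3) asks for the inequality only at the flats compatible with the flag.

    (P1) implies (P2). For incomparable sets [A] and [B] there is a rational curve
    in the permutohedral variety whose intersection number with
    [\sum_S c_S x_S] is [c_A + c_B - c_(A :&: B) - c_(A :|: B)], where the terms of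
    the empty and the full set are dropped ([wall_intersection]). A nef divisor is
    therefore a submodular function on the subsets, vanishing at the empty and at
    the full set ([nef_submodular]). The greedy algorithm, run along an ordering of
    the elements in which the members of the flag are initial segments, gives the
    tight linear minorant ([greedy_vector], [flag_ordering]). The curve is the
    projective line, with function field [k(t)]; all the bundles involved are
    multiples of the point at infinity, and the one delicate fact is that this
    point is the only pole of [t] ([infty_unique]).

    (P2) does not imply (P1). On the uniform matroid of rank 3 on 4 elements, with
    weights [-1, -1, 1, 1], take the maximum of [0] and of the total weight. On each
    flag one of these two linear functions is tight ([split_class_P2]), but no
    submodular function on all subsets restricts to this one
    ([split_class_not_P1]).

    (P3) does not imply (P2). On the uniform matroid of rank 3 on the vertices of a
    pentagon, take the value [1] on vertices, [0] on edges and [2] on diagonals. The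
    conditions around each flag are easily met ([pentagon_class_P3]), but a linear
    minorant tight at a vertex would violate the inequality at the opposite edge,
    which is not compatible with that vertex ([pentagon_class_not_P2]). *)

Set Implicit Arguments.
Unset Strict Implicit.
Unset Printing Implicit Defensive.
Import Order.TTheory GRing.Theory Num.Theory.
Local Open Scope ring_scope.

(** * Linear forms modulo the Chow relations *)

Lemma sum_indicator (E : finType) (R : pzSemiRingType) (S : {set E}) (y : E) :
  \sum_(x in S) (x == y)%:R = (y \in S)%:R :> R.
Proof.
have [yS|yS] := boolP (y \in S).
  by rewrite (bigD1 y) //= eqxx big1 ?addr0 // => x /andP[_ /negPf ->].
by rewrite big1 // => x xS; case: eqP yS => // <-; rewrite xS.
Qed.

Section ChowDegreeOne.
Variables (E : finType) (M : matroid E) (R : comNzRingType).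
Implicit Types (F : pflat M) (p q : chow_poly M R).

(** Coefficient of the monomial [x_F], taken as a derivative at the origin: the
    Leibniz rule then makes it blind to products of two variables. *)
Definition linear_coef F p : R := (p^`M(enum_rank F)).@[fun=> 0].

Lemma linear_coefB F p q :
  linear_coef F (p - q) = linear_coef F p - linear_coef F q.
Proof. by rewrite /linear_coef mderivB mevalB. Qed.

Lemma linear_coefD F p q :
  linear_coef F (p + q) = linear_coef F p + linear_coef F q.
Proof. by rewrite /linear_coef mderivD mevalD. Qed.

Lemma linear_coefM F p q :
  linear_coef F (p * q) =
    linear_coef F p * q.@[fun=> 0] + p.@[fun=> 0] * linear_coef F q.
Proof. by rewrite /linear_coef mderivM mevalD !mevalM. Qed.

Lemma linear_coef_var F G : linear_coef F (chow_var R G) = (F == G)%:R.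
Proof.
rewrite /linear_coef /chow_var mderivX mevalZ mnm1E (inj_eq enum_rank_inj).
rewrite eq_sym; case: eqP => [->|_]; last by rewrite mul0r.
have ->: ((U_(enum_rank G) - U_(enum_rank G)) = 0)%MM.
  by apply/mnmP=> i; rewrite mnmBE mnm0E subnn.
by rewrite mpolyX0 meval1 mulr1.
Qed.

Lemma linear_coef_sum (I : finType) (P : pred I) (p : I -> chow_poly M R) F :
  linear_coef F (\sum_(i | P i) p i) = \sum_(i | P i) linear_coef F (p i).
Proof.
apply: (big_morph (linear_coef F)) => [q r|]; first exact: linear_coefD.
by rewrite /linear_coef mderiv0 meval0.
Qed.

Lemma linear_coef_deg1 (c : pflat M -> R) F : linear_coef F (deg1 c) = c F.
Proof.
rewrite /deg1 linear_coef_sum (bigD1 F) //= big1 ?addr0.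
  rewrite /linear_coef mderivZ mevalZ -/(linear_coef _ _).
  by rewrite linear_coef_var eqxx mulr1.
move=> G /negPf neq; rewrite /linear_coef mderivZ mevalZ -/(linear_coef _ _).
by rewrite linear_coef_var eq_sym neq mulr0.
Qed.

Lemma chow_var_eval0 F : (chow_var R F).@[fun=> 0] = 0.
Proof. exact: mevalXU. Qed.

Lemma linear_coef_incident (i : E) F :
  linear_coef F (\sum_(G : pflat M | i \in val G) chow_var R G)
    = (i \in val F)%:R.
Proof.
rewrite linear_coef_sum; under eq_bigr do rewrite linear_coef_var.
have [iF|iF] := boolP (i \in val F).
  rewrite (bigD1 F) //= eqxx big1 ?addr0 // => G /andP[_ /negPf].
  by rewrite eq_sym => ->.
by rewrite big1 // => G iG; case: eqP iF => // ->; rewrite iG.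
Qed.

(** In degree one the quadratic monomials of [I] do not count, and a multiple
    [a * (\sum_(F \ni i) x_F - \sum_(F \ni j) x_F)] contributes only through
    the constant term of [a]: the vector [m] collects these constants, with sign,
    at the elements [i] and [j]. *)
Lemma chow_ideal_linear p : chow_ideal p ->
  exists2 m : E -> R, \sum_i m i = 0 &
    forall F, linear_coef F p = \sum_(i in val F) m i.
Proof.
case=> s [gens ->]; elim: s gens => [|[a g] s IHs] gens.
  exists (fun=> 0) => [|F]; first by rewrite big1.
  by rewrite big_nil /linear_coef mderiv0 meval0 big1.
have [|m m0 mE] := IHs; first by move=> ag ags; apply: gens; rewrite inE ags orbT.
have [[F1 [F2 [_ _ /= gE]]]|[i [j /= gE]]] := gens (a, g) (mem_head _ _).
  exists m => // F; rewrite big_cons linear_coefD mE /= gE !linear_coefM.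
  by rewrite mevalM !chow_var_eval0; ring.
pose a0 := a.@[fun=> 0].
exists (fun x => a0 * ((x == i)%:R - (x == j)%:R) + m x) => [|F].
  rewrite big_split /= m0 addr0 -mulr_sumr sumrB.
  have sumT (x : E) : \sum_(y : E) (y == x)%:R = 1 :> R.
    transitivity (\sum_(y in [set: E]) (y == x)%:R : R).
      by apply: eq_bigl => y; rewrite inE.
    by rewrite sum_indicator inE.
  by rewrite !sumT subrr mulr0.
rewrite big_cons linear_coefD mE big_split /= -mulr_sumr sumrB !sum_indicator.
have star0 x : (\sum_(G : pflat M | x \in val G) chow_var R G).@[fun=> 0] = 0.
  by rewrite raddf_sum big1 // => G _; apply: chow_var_eval0.
rewrite gE linear_coefM linear_coefB !linear_coef_incident.
by rewrite mevalB !star0 subrr mulr0 add0r.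
Qed.

(** Linear equivalence of toric divisors: the vectors [m] with sum zero are the
    characters of the torus, and [\sum_(i in val F) m i] is the pairing of such a
    character with the ray [e_F]. *)
Lemma chow_eq_deg1P (a b : pflat M -> R) :
  chow_eq (deg1 a) (deg1 b) <->
  exists2 m : E -> R, \sum_i m i = 0 &
    forall F, a F - b F = \sum_(i in val F) m i.
Proof.
split=> [/chow_ideal_linear[m m0 mE]|[m m0 mE]].
  by exists m => // F; rewrite -mE linear_coefB !linear_coef_deg1.
have dE : deg1 a - deg1 b = \sum_F (a F - b F) *: chow_var R F.
  by rewrite /deg1 -sumrB; apply: eq_bigr => F _; rewrite scalerBl.
rewrite /chow_eq dE.
have dsum : \sum_F (a F - b F) *: chow_var R F =
    \sum_i (m i)%:MP * \sum_(F : pflat M | i \in val F) chow_var R F.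
  transitivity (\sum_(F : pflat M) \sum_(i in val F) m i *: chow_var R F).
    by apply: eq_bigr => F _; rewrite mE scaler_suml.
  rewrite (exchange_big_dep predT) //=; apply: eq_bigr => i _.
  by rewrite mulr_sumr; apply: eq_bigr => F _; rewrite mul_mpolyC.
rewrite dsum; have [i0 _|E0] := pickP (@predT E); last first.
  exists [::]; split=> //; rewrite big_nil big1 // => i.
  by have := E0 i.
(* Since the m i sum to zero, all relations can be taken against one i0. *)
pose gen i := \sum_(F : pflat M | i \in val F) chow_var R F
  - \sum_(F : pflat M | i0 \in val F) chow_var R F.
exists [seq ((m i)%:MP, gen i) | i <- enum E]; split.
  by move=> ag /mapP[i _ ->]; right; exists i, i0.
rewrite big_map big_enum /=.
under [RHS]eq_bigr do rewrite mulrBr.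
by rewrite sumrB -mulr_suml -raddf_sum /= m0 mpolyC0 mul0r subr0.
Qed.

End ChowDegreeOne.

Lemma expressionP (E : finType) (M : matroid E) (l : pflat M -> int)
    (c : pflat M -> rat) :
  expression l c <-> exists2 m : E -> rat, \sum_i m i = 0 &
    forall F, c F = (l F)%:~R - \sum_(i in val F) m i.
Proof.
rewrite /expression chow_eq_deg1P; split=> -[m m0 mE]; exists m => // F.
  by rewrite -mE; ring.
by rewrite mE; ring.
Qed.

Lemma P2P (E : finType) (M : matroid E) (l : pflat M -> int) :
  P2 l <-> forall Fl : {set pflat M}, is_flag Fl ->
    exists2 m : E -> rat, \sum_i m i = 0 &
      (forall F : pflat M, F \in Fl -> \sum_(i in val F) m i = (l F)%:~R) /\
      (forall F : pflat M, \sum_(i in val F) m i <= (l F)%:~R).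
Proof.
split=> H Fl /H.
  case=> c [/expressionP[m m0 cE] c0 cge]; exists m => //.
  by split=> F => [/c0|]; [|have := cge F]; rewrite cE; lra.
case=> m m0 [mE mle].
exists (fun F : pflat M => (l F)%:~R - \sum_(i in val F) m i).
split=> [|F /mE ->|F]; first by apply/expressionP; exists m.
  by rewrite subrr.
by rewrite subr_ge0.
Qed.

Lemma P3P (E : finType) (M : matroid E) (l : pflat M -> int) :
  P3 l <-> forall Fl : {set pflat M}, is_flag Fl ->
    exists2 m : E -> rat, \sum_i m i = 0 &
      (forall F : pflat M, F \in Fl -> \sum_(i in val F) m i = (l F)%:~R) /\
      (forall F, F \notin Fl -> is_flag (F |: Fl) ->
         \sum_(i in val F) m i <= (l F)%:~R).
Proof.
split=> H Fl /H.
  case=> c [/expressionP[m m0 cE] c0 cge]; exists m => //.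
  by split=> F => [/c0|Fn Ff]; [|have := cge F Fn Ff]; rewrite cE; lra.
case=> m m0 [mE mle].
exists (fun F : pflat M => (l F)%:~R - \sum_(i in val F) m i).
split=> [|F /mE ->|F Fn Ff]; first by apply/expressionP; exists m.
  by rewrite subrr.
by rewrite subr_ge0 mle.
Qed.

Lemma P2_P3 (E : finType) (M : matroid E) (l : pflat M -> int) : P2 l -> P3 l.
Proof.
move=> H Fl /H[c [cE c0 cge]].
by exists c; split=> // F _ _.
Qed.

(** * Pullback from the permutohedral variety *)

Section ZeroExtension.
Variables (E : finType) (M : matroid E) (c : pflat M -> int).
(** The coefficients of a divisor as a function on all subsets; the value [0] at
    [set0] and at the ground set is the one that makes this function submodular
    when the divisor is nef. *)
Definition zero_ext (S : {set E}) : int := if insub S is Some F then c F else 0.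
Lemma zero_ext_out S : ~~ proper_flat M S -> zero_ext S = 0.
Proof. by move=> h; rewrite /zero_ext insubN. Qed.
Lemma sum_zero_ext S : \sum_(F : pflat M) c F * (val F == S)%:R = zero_ext S.
Proof.
rewrite /zero_ext; case: insubP => [F _ <-|nS].
  rewrite (bigD1 F) //= eqxx mulr1 big1 ?addr0 // => G /negPf.
  by rewrite -val_eqE => ->; rewrite mulr0.
rewrite big1 // => F _; case: eqP => [e|_]; last by rewrite mulr0.
by rewrite -e (valP F) in nS.
Qed.
End ZeroExtension.

Lemma pullback_deg1 (E : finType) (M : matroid E)
    (lt : pflat (boolean_matroid E) -> int) :
  pullback M (deg1 lt) = deg1 (fun F : pflat M => zero_ext lt (val F)).
Proof.
rewrite /pullback /deg1 raddf_sum /=.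
under eq_bigr => G _ do rewrite comp_mpolyZ /chow_var comp_mpolyXU -tnth_nth
  tnth_mktuple enum_rankK.
under [RHS]eq_bigr => F _ do rewrite -sum_zero_ext scaler_suml.
rewrite exchange_big /=; apply: eq_bigr => G _.
case: insubP => [F _ <-|nG].
  rewrite (bigD1 F) //= eqxx mulr1 big1 ?addr0 // => F' /negPf.
  by rewrite -val_eqE eq_sym => ->; rewrite mulr0 scale0r.
rewrite scaler0 big1 // => F _; case: eqP => [e|_]; last by rewrite mulr0 scale0r.
by rewrite e (valP F) in nG.
Qed.

Lemma P1_zero_ext (k : closedFieldType) (E : finType) (M : matroid E)
    (l : pflat M -> int) : P1 k l ->
  exists2 lt : pflat (boolean_matroid E) -> int, nef k lt &
  exists2 m : E -> int, \sum_i m i = 0 &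
    forall F : pflat M, l F = zero_ext lt (val F) - \sum_(i in val F) m i.
Proof.
case=> lt [nef_lt]; rewrite pullback_deg1 => /chow_eq_deg1P[m m0 mE].
by exists lt => //; exists m => // F; rewrite -mE; ring.
Qed.

(** * Submodularity implies (P2) *)

Definition submodular (E : finType) (g : {set E} -> int) : Prop :=
  forall A B : {set E}, g (A :&: B) + g (A :|: B) <= g A + g B.

(** Edmonds' greedy algorithm: the successive increments of [g] along [s] form a
    vector which agrees with [g] on the initial segments of [s]. When the last
    element [x] is added, submodularity of [g] at [S] and at the set of the
    earlier elements shows that the increment at [x] is at most
    [g S - g (S :\ x)], which bounds the sum over [S]. *)
Lemma greedy_vector (E : finType) (g : {set E} -> int) (s : seq E) :
  submodular g -> g set0 = 0 -> uniq s ->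
  exists m : E -> int,
    (forall S : {set E}, S \subset s -> \sum_(i in S) m i <= g S) /\
    (forall j, \sum_(i in [set x in take j s]) m i = g [set x in take j s]).
Proof.
move=> gsub g0; elim/last_ind: s => [_|s x IHs].
  exists (fun=> 0); split=> [S|j].
    move=> S0; suff -> : S = set0 by rewrite big_set0 g0.
    by apply/setP=> y; rewrite inE; apply/negP => /(subsetP S0).
  suff -> : [set y in take j [::]] = set0 :> {set E} by rewrite big_set0 g0.
  by apply/setP=> y; rewrite !inE.
rewrite rcons_uniq => /andP[xs /IHs[m [mle mE]]].
pose P := [set y in s].
have xP : x \notin P by rewrite inE.
pose m' y := if y == x then g (x |: P) - g P else m y.
have m'E (S : {set E}) : x \notin S -> \sum_(i in S) m' i = \sum_(i in S) m i.
  move=> xS; apply: eq_bigr => i iS; rewrite /m'.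
  by case: eqP iS xS => // -> ->.
have mP : \sum_(i in P) m i = g P.
  by have := mE (size s); rewrite take_size.
exists m'; split=> [S Ss|j].
  have [xS|xS] := boolP (x \in S); last first.
    rewrite m'E //; apply: mle; apply/subsetP=> y yS.
    have := subsetP Ss y yS; rewrite mem_rcons inE => /orP[/eqP yx|//].
    by rewrite yx (negPf xS) in yS.
  rewrite (big_setD1 x) //= m'E ?inE ?eqxx // {1}/m' eqxx.
  have SP : S :\ x \subset s.
    apply/subsetP=> y; rewrite !inE => /andP[yx /(subsetP Ss)].
    by rewrite mem_rcons inE (negPf yx).
  have := gsub S P.
  have -> : S :&: P = S :\ x.
    apply/setP=> y; rewrite !inE; case: (eqVneq y x) => [->|yx /=].
      by rewrite (negPf xs) andbF.
    have [yS|//] := boolP (y \in S).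
    by have := subsetP Ss y yS; rewrite mem_rcons inE (negPf yx).
  have -> : S :|: P = x |: P.
    apply/setP=> y; rewrite !inE; case: (eqVneq y x) => [->|yx /=].
      by rewrite xS.
    have [yS|//] := boolP (y \in S).
    by have := subsetP Ss y yS; rewrite mem_rcons inE (negPf yx) /= => ->.
  by have := mle _ SP; lia.
have [js|sj] := leqP j (size s).
  rewrite -cats1 takel_cat // m'E ?mE // inE.
  by apply: contra xs => /mem_take.
rewrite take_oversize ?size_rcons //.
have -> : [set y in rcons s x] = x |: P.
  by apply/setP=> y; rewrite !inE mem_rcons inE.
by rewrite big_setU1 //= m'E // mP /m' eqxx subrK.
Qed.

(** Sorting the elements by the number of members of the flag that miss them
    turns each member of the flag into an initial segment. *)
Lemma flag_ordering (E : finType) (M : matroid E) (Fl : {set pflat M}) :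
  is_flag Fl -> exists s : seq E, [/\ uniq s, forall x, x \in s &
    forall F, F \in Fl -> exists j, val F = [set x in take j s]].
Proof.
move=> flag.
pose key x := #|[set G in Fl | x \notin val G]|.
pose le x y := (key x <= key y)%N.
have le_trans : transitive le by move=> ? ? ?; apply: leq_trans.
have le_total : total le by move=> ? ?; apply: leq_total.
exists (sort le (enum E)); split=> [|x|F FFl].
- by rewrite sort_uniq enum_uniq.
- by rewrite mem_sort mem_enum.
set s := sort _ _.
have key_lt x y : x \in val F -> y \notin val F -> (key x < key y)%N.
  move=> xF yF; apply: proper_card; apply/properP; split; last first.
    by exists F; rewrite inE FFl ?yF // negbK.
  apply/subsetP=> G; rewrite !inE => /andP[GFl xG]; rewrite GFl /=.
  move: flag => /forall_inP /(_ F FFl) /forall_inP /(_ G GFl) /orP[FG|GF].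
    by rewrite (subsetP FG) in xG.
  by apply: contra yF; apply: (subsetP GF).
exists (find [pred x | x \notin val F] s); apply/setP=> x; rewrite !inE.
have := sort_sorted le_total (enum E); rewrite -/s => sorted_s.
have xs : x \in s by rewrite mem_sort mem_enum.
pose i := find [pred x | x \notin val F] s.
have take_in : all (mem (val F)) (take i s).
  apply/(all_nthP x) => j; rewrite size_take_min leq_min => /andP[ji _].
  rewrite nth_take // -[X in is_true X]negbK.
  by have /= -> := before_find x ji.
apply/idP/idP => [xF|]; last exact: (allP take_in).
move: xs; rewrite -{1}(cat_take_drop i s) mem_cat => /orP[//|].
case dE: (drop i s) => [//|y t] xt.
have yF : y \notin val F.
  have lt_is : (i < size s)%N.
    rewrite ltnNge; apply: contra_eqN dE => /drop_oversize ->; by [].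
  have /(nth_find y) /= : has [pred x | x \notin val F] s by rewrite has_find.
  by have := nth_drop i y s 0; rewrite dE addn0 /= -/i => <-.
have := drop_sorted i sorted_s; rewrite dE /= => /(order_path_min le_trans)/allP.
move: xt; rewrite inE => /orP[/eqP xy|xt /(_ x xt)].
  by case/negP: yF; rewrite -xy.
by rewrite /le leqNgt key_lt.
Qed.

Lemma submodular_P2 (E : finType) (M : matroid E) (l : pflat M -> int)
    (g : {set E} -> int) (m : E -> int) :
  submodular g -> g set0 = 0 -> g [set: E] = 0 -> \sum_i m i = 0 ->
  (forall F : pflat M, l F = g (val F) - \sum_(i in val F) m i) -> P2 l.
Proof.
move=> gsub g0 gT m0 lE; apply/P2P => Fl /flag_ordering[s [s_uniq s_all sFl]].
have [u [ule uE]] := greedy_vector gsub g0 s_uniq.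
exists (fun x => (u x - m x)%:~R).
  have sum_u : \sum_i u i = 0.
    transitivity (\sum_(i in [set: E]) u i).
      by apply: eq_bigl => i; rewrite inE.
    rewrite -[RHS]gT; have := uE (size s); rewrite take_size.
    suff -> : [set x in s] = [set: E] by [].
    by apply/setP=> x; rewrite !inE s_all.
  by rewrite -rmorph_sum sumrB m0 sum_u.
split=> F; rewrite -rmorph_sum sumrB lE.
  by case/sFl=> j ->; rewrite uE.
by rewrite ler_int lerD2r ule //; apply/subsetP=> x _; apply: s_all.
Qed.

(** * The projective line and its point at infinity *)

Section PlacesOfCurves.
Variable k : closedFieldType.

Lemma place_ext (C : curve k) (v w : place C) : ord v =1 ord w -> v = w.
Proof.
case: v w => [v ? ? ? ? ?] [w ? ? ? ? ?] /= /functional_extensionality vw.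
by subst w; congr Place; apply: proof_irrelevance.
Qed.

Lemma ordV (C : curve k) (v : place C) (f : C) :
  f != 0 -> ord v f^-1 = - ord v f.
Proof.
move=> f0; have := ordM v f0 (_ : f^-1 != 0); rewrite invr_eq0 divff // => /(_ f0).
rewrite -(rmorph1 (curve_const C)) ord_const; lia.
Qed.

Lemma ord_div (C : curve k) (v : place C) (f g : C) : f != 0 -> g != 0 ->
  ord v (f / g) = ord v f - ord v g.
Proof. by move=> f0 g0; rewrite ordM ?invr_eq0 // ordV. Qed.

Lemma ordN (C : curve k) (v : place C) (f : C) : ord v (- f) = ord v f.
Proof.
have [->|f0] := eqVneq f 0; first by rewrite oppr0.
rewrite -mulN1r ordM ?oppr_eq0 ?oner_neq0 //.
by rewrite -(rmorph1 (curve_const C)) -rmorphN ord_const add0r.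
Qed.

(** If the value of [f + g] were larger than that of [f], then the ultrametric
    inequality would fail for [f = (f + g) - g]. *)
Lemma ordD_lt (C : curve k) (v : place C) (f g : C) :
  f != 0 -> g != 0 -> ord v f < ord v g -> f + g != 0 /\ ord v (f + g) = ord v f.
Proof.
move=> f0 g0 fg.
have fg0 : f + g != 0.
  by apply: contraTneq fg => /eqP; rewrite addr_eq0 => /eqP ->; rewrite ordN ltxx.
split=> //; have := ordD v f0 g0 fg0.
have := ordD v fg0 (_ : - g != 0); rewrite oppr_eq0 addrK ordN => /(_ g0 f0).
lia.
Qed.

End PlacesOfCurves.

Local Open Scope quotient_scope.

Local Notation "x %:F" := (@FracField.tofrac _ x) : ring_scope.

Lemma frac_decomp (R : idomainType) (f : {fraction R}) :
  exists n d : R, d != 0 /\ f = n%:F / d%:F.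
Proof.
elim/quotW: f => x; exists (frac x).1, (frac x).2.
split; first exact: denom_ratioP.
apply: canRL (mulfK _) _; first by rewrite tofrac_eq0 denom_ratioP.
unlock FracField.tofrac; rewrite -[LHS]FracField.pi_mul.
apply/eqmodP; rewrite /= FracField.equivfE /FracField.mulf.
by rewrite !numden_Ratio ?mulr1 ?oner_neq0 ?denom_ratioP // mulrC.
Qed.

Lemma cross_multiply (F : fieldType) (n d a b : F) :
  d != 0 -> n / d * b = a -> n * b = d * a.
Proof. by move=> d0 <-; rewrite mulrA [d * _]mulrC divfK. Qed.

(** On the fraction field of a domain, minus the degree is a valuation. This is
    stated for an abstract degree function; the case of interest is that of
    polynomials. *)
Section DegreeValuation.
Variables (R : idomainType) (deg : R -> nat).
Hypothesis degM : forall a b,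
  a != 0 -> b != 0 -> deg (a * b) = (deg a + deg b)%N.
Hypothesis degD : forall a b, (deg (a + b) <= maxn (deg a) (deg b))%N.
Local Notation K := {fraction R}.

Definition degree_ord (f : K) : int :=
  if f == 0 then 0
  else (deg (frac (repr f)).2)%:Z - (deg (frac (repr f)).1)%:Z.

Lemma degree_ordE (n d : R) : n != 0 -> d != 0 ->
  degree_ord (n%:F / d%:F) = (deg d)%:Z - (deg n)%:Z.
Proof.
move=> n0 d0; set f := _ / _.
have f0 : f != 0 by rewrite mulf_neq0 ?invr_eq0 ?tofrac_eq0.
rewrite /degree_ord (negPf f0).
set x := repr f; have x2 : (frac x).2 != 0 by apply: denom_ratioP.
have fE : f * (frac x).2%:F = (frac x).1%:F.
  rewrite -[f]reprK -/x; unlock FracField.tofrac.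
  rewrite -[LHS]FracField.pi_mul.
  apply/eqmodP; rewrite /= FracField.equivfE /FracField.mulf.
  by rewrite !numden_Ratio ?mulr1 ?oner_neq0 ?denom_ratioP // mulrC.
have cross : n * (frac x).2 = d * (frac x).1.
  apply/eqP; rewrite -tofrac_eq !tofracM; apply/eqP.
  by apply: cross_multiply fE; rewrite tofrac_eq0.
have x1 : (frac x).1 != 0.
  by rewrite -tofrac_eq0 -fE mulf_neq0 ?tofrac_eq0.
move/(congr1 deg): cross; rewrite !degM //; lia.
Qed.

Lemma frac_decomp_neq0 (f : K) : f != 0 ->
  exists n d : R, [/\ n != 0, d != 0 & f = n%:F / d%:F].
Proof.
have [n [d [d0 ->]]] := frac_decomp f => nd0.
by exists n, d; split=> //; apply: contraNneq nd0 => ->; rewrite tofrac0 mul0r.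
Qed.

Lemma degree_ord0 : degree_ord 0 = 0. Proof. by rewrite /degree_ord eqxx. Qed.

Lemma degree_ordM (f g : K) : f != 0 -> g != 0 ->
  degree_ord (f * g) = degree_ord f + degree_ord g.
Proof.
move=> /frac_decomp_neq0[a [b [a0 b0 ->]]] /frac_decomp_neq0[c [d [c0 d0 ->]]].
rewrite mulf_div -!tofracM !degree_ordE ?mulf_neq0 // !degM //; lia.
Qed.

Lemma degree_ordD (f g : K) : f != 0 -> g != 0 -> f + g != 0 ->
  Num.min (degree_ord f) (degree_ord g) <= degree_ord (f + g).
Proof.
move=> /frac_decomp_neq0[a [b [a0 b0 ->]]] /frac_decomp_neq0[c [d [c0 d0 ->]]].
rewrite addf_div ?tofrac_eq0 // -!tofracM -tofracD => fg0.
have n0 : a * d + c * b != 0.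
  by apply: contraNneq fg0 => ->; rewrite tofrac0 mul0r.
rewrite !degree_ordE ?mulf_neq0 //.
have := degD (a * d) (c * b); rewrite !degM //; lia.
Qed.

End DegreeValuation.

Definition poly_deg (R : idomainType) (p : {poly R}) : nat := (size p).-1.

Lemma poly_degM (R : idomainType) (p q : {poly R}) : p != 0 -> q != 0 ->
  poly_deg (p * q) = (poly_deg p + poly_deg q)%N.
Proof.
move=> p0 q0; rewrite /poly_deg size_mul //.
by move: p0 q0; rewrite -!size_poly_gt0; lia.
Qed.

Lemma poly_degD (R : idomainType) (p q : {poly R}) :
  (poly_deg (p + q) <= maxn (poly_deg p) (poly_deg q))%N.
Proof. by have := size_polyD p q; rewrite /poly_deg; lia. Qed.

Lemma poly_degC (R : idomainType) (c : R) : poly_deg c%:P = 0%N.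
Proof. by rewrite /poly_deg size_polyC; case: (c != 0). Qed.

Lemma poly_degX (R : idomainType) : poly_deg ('X : {poly R}) = 1%N.
Proof. by rewrite /poly_deg size_polyX. Qed.

Lemma poly_degMXaddC (R : idomainType) (p : {poly R}) (c : R) : p != 0 ->
  poly_deg (p * 'X + c%:P) = (poly_deg p).+1.
Proof.
by move=> p0; rewrite /poly_deg size_MXaddC (negPf p0) prednK ?size_poly_gt0.
Qed.

Section RationalCurve.
Variable k : closedFieldType.
Local Notation K := {fraction {poly k}}.

Definition const_frac : {rmorphism k -> K} :=
  GRing.RMorphism.clone _ _ (@FracField.tofrac {poly k} \o polyC) _.

Definition coord : K := 'X%:F.

Lemma horner_coord (p : {poly k}) : (map_poly const_frac p).[coord] = p%:F.
Proof.
rewrite /coord -[map_poly _ p]/(map_poly (@FracField.tofrac _ \o polyC) p).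
rewrite map_poly_comp horner_map; congr (_ %:F).
exact: comp_polyXr.
Qed.

Fact rational_curveP : exists t : K,
    (forall p : {poly k}, p != 0 -> (map_poly const_frac p).[t] != 0) /\
    exists (n : nat) (b : 'I_n -> K), forall y : K,
      exists (q : {poly k}) (p : 'I_n -> {poly k}), q != 0 /\
        (map_poly const_frac q).[t] * y
        = \sum_i (map_poly const_frac (p i)).[t] * b i.
Proof.
exists coord; split=> [p p0|]; first by rewrite horner_coord tofrac_eq0.
exists 1%N, (fun=> 1) => y; have [n [d [d0 ->]]] := frac_decomp y.
exists d, (fun=> n); split=> //.
by rewrite big_ord1 !horner_coord mulr1 mulrC divfK ?tofrac_eq0.
Qed.

Definition rational_curve : curve k := Curve rational_curveP.

Local Notation ord_infty := (degree_ord (@poly_deg k)).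

Fact ord_infty_const (c : k) : ord_infty (const_frac c) = 0.
Proof.
have [->|c0] := eqVneq c 0; first by rewrite rmorph0 degree_ord0.
rewrite -[const_frac c]divr1 -[const_frac c]/(c%:P%:F) -tofrac1.
rewrite (degree_ordE (@poly_degM k)) ?polyC_eq0 ?oner_neq0 //.
by rewrite -polyC1 (poly_degC (1 : k)) (poly_degC c).
Qed.

Fact ord_infty_onto : exists2 f : K, f != 0 & ord_infty f = 1.
Proof.
exists (1%:F / 'X%:F).
  by rewrite mulf_neq0 ?invr_eq0 ?tofrac_eq0 ?oner_neq0 ?polyX_eq0.
rewrite (degree_ordE (@poly_degM k)) ?oner_neq0 ?polyX_eq0 //.
by rewrite -polyC1 (poly_degC (1 : k)) (poly_degX k).
Qed.

Definition infty : place rational_curve :=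
  @Place k rational_curve ord_infty (degree_ord0 (@poly_deg k))
    (degree_ordM (@poly_degM k))
    (degree_ordD (@poly_degM k) (@poly_degD k)) ord_infty_const ord_infty_onto.

Lemma ord_infty_coord : ord infty coord = -1.
Proof.
rewrite -[coord]divr1 -tofrac1 /=.
rewrite (degree_ordE (@poly_degM k)) ?polyX_eq0 ?oner_neq0 //.
by rewrite -polyC1 (poly_degC (1 : k)) (poly_degX k).
Qed.

Lemma ord_poly (v : place rational_curve) (p : {poly k}) :
  ord v coord < 0 -> p != 0 ->
  ord v (p%:F : rational_curve) = (@poly_deg k p)%:Z * ord v coord.
Proof.
move=> vt; have X0 : 'X != 0 :> {poly k} by rewrite polyX_eq0.
have t0 : coord != 0 by rewrite tofrac_eq0.
elim/poly_ind: p => [|p c IHp]; first by rewrite eqxx.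
have vc (a : k) : ord v (a%:P%:F : rational_curve) = 0 by apply: (ord_const v).
have [->|p0] := eqVneq p 0.
  by rewrite mul0r add0r (poly_degC c) vc mul0r.
move=> _; rewrite (poly_degMXaddC c p0).
have pX0 : (p * 'X)%:F != 0 :> K by rewrite tofrac_eq0 mulf_neq0.
have vpX : ord v ((p * 'X)%:F : rational_curve)
    = (@poly_deg k p).+1%:Z * ord v coord.
  by rewrite tofracM (@ordM _ _ v p%:F) ?tofrac_eq0 // IHp //
    intS mulrDl mul1r addrC.
have [->|c0] := eqVneq c 0; first by rewrite addr0.
have [|||_ vD] := @ordD_lt k rational_curve v (p * 'X)%:F c%:P%:F.
- exact: pX0.
- by rewrite tofrac_eq0 polyC_eq0.
- by rewrite vpX vc; nia.
by rewrite tofracD vD vpX.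
Qed.

(** A place with a pole at the coordinate takes the value [deg p * v t] at each
    polynomial [p], hence is a multiple of the valuation at infinity; being
    normalized, it is equal to it. *)
Lemma infty_unique (v : place rational_curve) : ord v coord < 0 -> v = infty.
Proof.
move=> vt; have vE := ord_poly vt.
have v_div : forall f g : K, f != 0 -> g != 0 ->
    ord v (f / g) = ord v f - ord v g := @ord_div k rational_curve v.
have frac_ord (f : K) : f != 0 -> ord v f = - ord v coord * ord infty f.
  move=> /frac_decomp_neq0[a [b [a0 b0 ->]]].
  have -> : ord infty (a%:F / b%:F) = (@poly_deg k b)%:Z - (@poly_deg k a)%:Z.
    exact: (degree_ordE (@poly_degM k)).
  rewrite v_div ?tofrac_eq0 // (vE a) // (vE b) //; ring.
apply: place_ext => f; have [->|f0] := eqVneq f 0; first by rewrite !Defs.ord0.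
have [g g0 gE] := ord_onto v; have := frac_ord g g0; rewrite gE.
rewrite (frac_ord f f0); move: (ord v coord) (ord infty g) vt => o x o0 ox.
have x0 : 0 < x by nia.
have o_ge : -1 <= o by nia.
have -> : o = -1 by lia.
by rewrite opprK mul1r.
Qed.

End RationalCurve.

(** * Nef divisors on the permutohedral variety are submodular *)

Section PoleDivisor.
Variable k : closedFieldType.
Local Notation P1k := (rational_curve k).

(** The point at infinity as a divisor, written as the polar part of the
    coordinate so that no equality test on places is required. *)
Definition pole_order (v : place P1k) : int :=
  if ord v (coord k) < 0 then - ord v (coord k) else 0.

Fact pole_supp_uniq : List.NoDup [:: infty k].
Proof. by constructor; [case | constructor]. Qed.

Fact pole_supp_mult n v : n * pole_order v <> 0 -> List.In v [:: infty k].
Proof.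
rewrite /pole_order; case: ifP => [/infty_unique -> _|_]; first by left.
by rewrite mulr0.
Qed.

Definition pole_divisor (n : int) : divisor P1k :=
  @Divisor k P1k (fun v => n * pole_order v) [:: infty k]
    pole_supp_uniq (@pole_supp_mult n).

Lemma pole_divisor_deg n : div_deg (pole_divisor n) = n.
Proof.
rewrite /div_deg /pole_divisor /= big_seq1 /= /pole_order.
by rewrite ord_infty_coord mulr1.
Qed.
End PoleDivisor.

Lemma proper_flat_boolean (E : finType) (S : {set E}) :
  proper_flat (boolean_matroid E) S = (S != set0) && (S != [set: E]).
Proof.
rewrite /proper_flat; set f := flat _ _; suff -> : f by [].
have rk (A : {set E}) : rank (boolean_matroid E) A = #|A|.
  apply/eqP; rewrite eqn_leq; apply/andP; split.
    by apply/bigmax_leqP => B /andP[_ /subset_leq_card].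
  apply: (@leq_bigmax_cond _ _ (fun B : {set E} => #|B|) A).
  by rewrite inE subxx.
apply/forall_inP => x; rewrite inE => xS; rewrite !rk cardsU1 xS.
by rewrite add1n.
Qed.

Section WallCurve.
Variables (k : closedFieldType) (E : finType) (A B : {set E}).
Hypotheses (AB : ~~ (A \subset B)) (BA : ~~ (B \subset A)).
Local Notation U := (boolean_matroid E).
Local Notation P1k := (rational_curve k).

(** The relation [e_A + e_B = e_(A :&: B) + e_(A :|: B)] gives the degrees of
    the line bundles on a rational curve that lies in the orbit closure of the
    cone spanned by [e_(A :&: B)] and [e_(A :|: B)]. *)
Definition wall_deg (S : {set E}) : int :=
  (S == A)%:R + (S == B)%:R - (S == A :&: B)%:R - (S == A :|: B)%:R.

(** With every bundle a multiple of the point at infinity, the section [1] of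
    the bundle of [A] vanishes at infinity only, and the coordinate, as a section
    of the bundle of [B], vanishes at the origin only. So the coordinates of [A]
    and [B] have no common zero, as the incomparability of [A] and [B] demands. *)
Definition wall_sect (F : pflat U) : P1k :=
  if (val F == A :&: B) || (val F == A :|: B) then 0
  else if val F == B then coord k else 1.

Let AneB : (A == B) = false. Proof. by apply: contraNF AB => /eqP ->. Qed.
Let AneI : (A == A :&: B) = false.
Proof. by apply: contraNF AB => /eqP ->; apply: subsetIr. Qed.
Let AneU : (A == A :|: B) = false.
Proof. by apply: contraNF BA => /eqP ->; apply: subsetUr. Qed.
Let BneI : (B == A :&: B) = false.
Proof. by apply: contraNF BA => /eqP ->; apply: subsetIl. Qed.
Let BneU : (B == A :|: B) = false.
Proof. by apply: contraNF AB => /eqP ->; apply: subsetUl. Qed.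

Lemma wall_degA : wall_deg A = 1.
Proof. by rewrite /wall_deg eqxx AneB AneI AneU. Qed.
Lemma wall_degB : wall_deg B = 1.
Proof. by rewrite /wall_deg eqxx eq_sym AneB BneI BneU. Qed.

Variant wall_spec (F : pflat U) : P1k -> int -> Type :=
  | WallStratum of (val F == A :&: B) || (val F == A :|: B) :
      wall_spec F 0 (wall_deg (val F))
  | WallA of val F = A : wall_spec F 1 1
  | WallB of val F = B : wall_spec F (coord k) 1
  | WallOther : wall_spec F 1 0.

Lemma wallP F : wall_spec F (wall_sect F) (wall_deg (val F)).
Proof.
rewrite /wall_sect; case: ifPn => [h|/norP[/negPf nI /negPf nU]].
  exact: WallStratum.
have [FB|/negPf nB] := eqVneq (val F) B.
  by rewrite FB wall_degB; apply: WallB.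
have [FA|/negPf nA] := eqVneq (val F) A.
  by rewrite FA wall_degA; apply: WallA.
by rewrite /wall_deg nI nU nB nA; apply: WallOther.
Qed.

Let coord_neq0 : coord k != 0.
Proof. by rewrite tofrac_eq0 polyX_eq0. Qed.

Let ord1 (v : place P1k) : ord v (1 : P1k) = 0.
Proof. by rewrite -(rmorph1 (curve_const P1k)) ord_const. Qed.

Fact wall_sectP F v : wall_sect F != 0 ->
  0 <= ord v (wall_sect F) + pole_divisor k (wall_deg (val F)) v.
Proof.
rewrite /= /pole_order.
case: wallP => [_|FA|FB|]; rewrite ?eqxx // => _.
- by rewrite ord1; case: ifP => h; lia.
- by case: ifP => h; lia.
- by rewrite ord1 mul0r.
Qed.

Fact wall_bundleP (i j : E) : principal (fun v : place P1k =>
    \sum_(F : pflat U | i \in val F) pole_divisor k (wall_deg (val F)) v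
    - \sum_(F : pflat U | j \in val F) pole_divisor k (wall_deg (val F)) v).
Proof.
(* The total degree over the sets containing x does not depend on x; it is 0,
   or 1 when the term of A :|: B is missing because this set is not proper. *)
have wall_sum x v :
    \sum_(F : pflat U | x \in val F) pole_divisor k (wall_deg (val F)) v
    = (A :|: B == [set: E])%:R * pole_order v.
  rewrite /= -mulr_suml big_mkcond /=; congr (_ * _).
  transitivity (\sum_(F : pflat U) (x \in val F)%:R * wall_deg (val F)).
    by apply: eq_bigr => F _; case: ifP; rewrite ?mul1r ?mul0r.
  have sumS (S : {set E}) :
      \sum_(F : pflat U) (x \in val F)%:R * (val F == S)%:R
      = (x \in S)%:R - (S == [set: E])%:R :> int.
    rewrite (sum_zero_ext (fun F : pflat U => (x \in val F)%:R)).
    have [Sp|Sn] := boolP (proper_flat U S).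
      rewrite /zero_ext insubT /=; move: Sp; rewrite proper_flat_boolean.
      by case/andP=> _ /negPf ->; rewrite subr0.
    rewrite zero_ext_out //; move: Sn.
    rewrite proper_flat_boolean negb_and !negbK.
    case/orP=> /eqP ->; last by rewrite inE eqxx subrr.
    rewrite inE; case: eqP => // /setP/(_ x); rewrite !inE //.
  rewrite /wall_deg.
  under eq_bigr => F _ do rewrite !mulrBr mulrDr.
  rewrite !sumrB big_split /= !sumS !inE.
  have AT : (A == [set: E]) = false.
    by apply: contraNF BA => /eqP ->; apply: subsetT.
  have BT : (B == [set: E]) = false.
    by apply: contraNF AB => /eqP ->; apply: subsetT.
  have IT : (A :&: B == [set: E]) = false.
    by apply: contraFF AT => /eqP IT; rewrite -subTset -IT subsetIl.
  rewrite AT BT IT; case: (x \in A); case: (x \in B) => /=; ring.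
exists 1; first exact: oner_neq0.
by move=> v; rewrite !wall_sum subrr ord1.
Qed.

Fact wall_coneP (v : place P1k) : exists Fl : {set pflat U}, is_flag Fl /\
  forall F, wall_sect F = 0 \/
    0 < ord v (wall_sect F) + pole_divisor k (wall_deg (val F)) v -> F \in Fl.
Proof.
pose X := if ord v (coord k) < 0 then A else B.
exists [set F : pflat U | val F \in [:: A :&: B; X; A :|: B]]; split.
  apply/forall_inP => F; rewrite !inE => FX.
  apply/forall_inP => G; rewrite !inE => GX.
  have IX : A :&: B \subset X.
    by rewrite /X; case: ifP; rewrite (subsetIl, subsetIr).
  have XU : X \subset A :|: B.
    by rewrite /X; case: ifP; rewrite (subsetUl, subsetUr).
  have IU := subset_trans IX XU.
  by case/or3P: FX => /eqP ->; case/or3P: GX => /eqP ->;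
    rewrite ?subxx ?IX ?XU ?IU ?orbT.
move=> F; rewrite !inE /= /pole_order; case: wallP => [/orP[]->|FA|FB|].
- by [].
- by rewrite !orbT.
- case=> [/eqP|]; first by rewrite oner_eq0.
  by rewrite ord1 /X; case: ifP => [_ _|_]; rewrite ?FA ?eqxx ?orbT ?mulr0.
- case=> [/eqP|]; first by rewrite (negPf coord_neq0).
  rewrite /X; case: ifP => [_|_ _]; last by rewrite FB eqxx orbT.
  by rewrite mul1r subrr ltxx.
- case=> [/eqP|]; first by rewrite oner_eq0.
  by rewrite ord1 mul0r.
Qed.

Definition wall_curve : curve_map P1k U :=
  CurveMap wall_sectP wall_bundleP wall_coneP.

Lemma wall_intersection (c : pflat U -> int) :
  intersection_number wall_curve c =
    zero_ext c A + zero_ext c B - zero_ext c (A :&: B) - zero_ext c (A :|: B).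
Proof.
rewrite /intersection_number; under eq_bigr => F _ do
  rewrite pole_divisor_deg /wall_deg !mulrBr mulrDr.
by rewrite !sumrB big_split /= !sum_zero_ext.
Qed.

End WallCurve.

Lemma nef_submodular (k : closedFieldType) (E : finType)
    (c : pflat (boolean_matroid E) -> int) : nef k c -> submodular (zero_ext c).
Proof.
move=> nef_c A B.
have [/setIidPl AB|AB] := boolP (A \subset B).
  by rewrite AB (setUidPr _) ?lerr //; apply/setIidPl.
have [BA|BA] := boolP (B \subset A).
  by rewrite (setIidPr BA) (setUidPl BA) addrC.
have := nef_c _ (wall_curve k AB BA); rewrite wall_intersection; lia.
Qed.

(** A nef lift of [l] is a submodular function on all subsets, whose greedy
    vectors are linear minorants tight on a given flag; restricting to the flats
    of [M] keeps both properties. *)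
Lemma P1_P2 (k : closedFieldType) (E : finType) (M : matroid E)
    (l : pflat M -> int) : P1 k l -> P2 l.
Proof.
case/P1_zero_ext=> c /nef_submodular c_sub [m m0 lE].
apply: (submodular_P2 c_sub _ _ m0 lE); apply: zero_ext_out;
  by rewrite proper_flat_boolean eqxx ?andbF.
Qed.

(** * Uniform matroids *)

Lemma exists_subset_of_card (T : finType) (A : {set T}) n :
  (n <= #|A|)%N -> exists2 B : {set T}, B \subset A & #|B| = n.
Proof.
rewrite -bin_gt0 -cards_draws => /card_gt0P[B].
by rewrite inE => /andP[BA /eqP Bn]; exists B.
Qed.

Program Definition uniform_matroid (E : finType) (r : nat) : matroid E :=
  @Matroid E [set A : {set E} | (#|A| <= r)%N] _ _ _.
Next Obligation. by rewrite inE cards0. Qed.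
Next Obligation.
by move: H0; rewrite !inE; apply: leq_trans; apply: subset_leq_card.
Qed.
Next Obligation.
move: H H0; rewrite !inE => Ar Br.
have /subsetPn[x xB xA] : ~~ (B \subset A).
  by apply: contraL H1 => /subset_leq_card; rewrite leqNgt.
exists x; rewrite ?inE ?xA // cardsU1 xA; lia.
Qed.

Lemma loopless_uniform (E : finType) r : (0 < r)%N ->
  loopless (uniform_matroid E r).
Proof. by move=> r0 x; rewrite inE cards1. Qed.

Lemma rank_uniform (E : finType) r (A : {set E}) :
  rank (uniform_matroid E r) A = minn #|A| r.
Proof.
apply/eqP; rewrite eqn_leq; apply/andP; split.
  apply/bigmax_leqP => B /andP[]; rewrite inE leq_min => -> BA.
  by rewrite subset_leq_card.
have [B BA Bn] := exists_subset_of_card (geq_minl #|A| r).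
rewrite -Bn; apply: (@leq_bigmax_cond _ _ (fun B : {set E} => #|B|)).
by rewrite inE Bn geq_minr.
Qed.

Lemma proper_flat_uniform (E : finType) r (F : {set E}) : (r <= #|E|)%N ->
  proper_flat (uniform_matroid E r) F = (0 < #|F| < r)%N.
Proof.
move=> rE; rewrite /proper_flat card_gt0 andbCA; congr (_ && _).
apply/andP/idP => [[/forall_inP flatF FT]|Fr].
  have /subsetPn[x _ xF] : ~~ ([set: E] \subset F) by rewrite subTset.
  have := flatF x; rewrite inE => /(_ xF); rewrite !rank_uniform cardsU1 xF.
  lia.
split; last by apply: contraTneq Fr => ->; rewrite cardsT -leqNgt.
apply/forall_inP => x; rewrite inE => xF; rewrite !rank_uniform cardsU1 xF.
lia.
Qed.

Section RankThree.
Variables (E : finType) (E3 : (2 < #|E|)%N).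
Local Notation M := (uniform_matroid E 3).

Variant point_or_line (S : {set E}) : Prop :=
  | IsPoint x of S = [set x]
  | IsLine x y of x != y & S = [set x; y].

Lemma pflat_uniform3P (F : pflat M) : point_or_line (val F).
Proof.
have := valP F; rewrite /= proper_flat_uniform //.
case cF: #|val F| => [|[|[|//]]] // _.
  have /cards1P[x Fx] : #|val F| == 1%N by rewrite cF.
  exact: IsPoint Fx.
have /cards2P[x [y [xy Fxy]]] : #|val F| == 2 by rewrite cF.
exact: IsLine xy Fxy.
Qed.

Fact point_proper x : proper_flat M [set x].
Proof. by rewrite proper_flat_uniform // cards1. Qed.
Fact line_proper x y : proper_flat M [set x; y].
Proof. by rewrite proper_flat_uniform // cards2; case: eqP. Qed.
Definition point x : pflat M := Sub [set x] (point_proper x).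
Definition line x y : pflat M := Sub [set x; y] (line_proper x y).
End RankThree.

Lemma sum_set2 (E : finType) (V : nmodType) (f : E -> V) x y : x != y ->
  \sum_(i in [set x; y]) f i = f x + f y.
Proof. by move=> xy; rewrite big_setU1 ?big_set1 // inE. Qed.

Lemma is_flag1 (E : finType) (M : matroid E) (F : pflat M) : is_flag [set F].
Proof.
apply/forall_inP => G /set1P ->; apply/forall_inP => H /set1P ->.
by rewrite subxx.
Qed.

Lemma flag_comparable (E : finType) (M : matroid E) (Fl : {set pflat M}) F G :
  is_flag Fl -> F \in Fl -> G \in Fl ->
  (val F \subset val G) || (val G \subset val F).
Proof. by move=> /forall_inP flag /flag /forall_inP; apply. Qed.

Section Comparable.
Variables (E : finType) (E3 : (2 < #|E|)%N).
Local Notation M := (uniform_matroid E 3).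
Implicit Types (F G : pflat M) (p : E).

Lemma comparable_point G p :
  (val G \subset [set p]) || ([set p] \subset val G) ->
  val G = [set p] \/ exists2 y, p != y & val G = [set p; y].
Proof.
case: (pflat_uniform3P E3 G) => [x ->|x y xy ->].
  by rewrite !sub1set !inE eq_sym orbb => /eqP ->; left.
rewrite subUset !sub1set !inE => H; right.
have {H} /orP[/eqP ->|/eqP ->] : (p == x) || (p == y).
  by case/orP: H => [/andP[/eqP <-]|]; rewrite ?eqxx.
  by exists y.
by exists x; rewrite 1?eq_sym // setUC.
Qed.

Lemma comparable_line G a b : a != b ->
  (val G \subset [set a; b]) || ([set a; b] \subset val G) ->
  [\/ val G = [set a], val G = [set b] | val G = [set a; b]].
Proof.
move=> ab; case: (pflat_uniform3P E3 G) => [x ->|x y xy ->].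
  rewrite sub1set subUset !sub1set !inE => H.
  have {H} /orP[/eqP ->|/eqP ->] : (x == a) || (x == b).
  - by case/orP: H => // /andP[/eqP <-]; rewrite eqxx.
  - exact: Or31.
  - exact: Or32.
move=> H; apply: Or33; apply/eqP.
by case/orP: H => H; [|rewrite eq_sym]; rewrite eqEcard H !cards2 ab xy.
Qed.
End Comparable.

(** * A class on the uniform matroid of rank 3 on 4 elements with (P2), not (P1) *)

Section P2notP1.
Local Notation M := (uniform_matroid 'I_4 3).
Definition split_weight (i : 'I_4) : int := if (i < 2)%N then -1 else 1.
Definition split_sum (F : pflat M) : int := \sum_(i in val F) split_weight i.
Definition split_class (F : pflat M) : int := Num.max 0 (split_sum F).

Let E3 : (2 < #|'I_4|)%N. Proof. by rewrite card_ord. Qed.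

Lemma split_sum_pos F x : 0 < split_sum F -> x \in val F -> split_weight x = 1.
Proof.
rewrite /split_sum; case: (pflat_uniform3P E3 F) => [y ->|y z yz ->].
  by rewrite big_set1 inE => h /eqP ->; move: h; rewrite /split_weight; case: ifP.
rewrite sum_set2 // !inE => h /orP[]/eqP ->;
  by move: h; rewrite /split_weight; case: ifP; case: ifP.
Qed.

Lemma split_sum_neg F x : split_sum F < 0 -> x \in val F -> split_weight x = -1.
Proof.
rewrite /split_sum; case: (pflat_uniform3P E3 F) => [y ->|y z yz ->].
  by rewrite big_set1 inE => h /eqP ->; move: h; rewrite /split_weight; case: ifP.
rewrite sum_set2 // !inE => h /orP[]/eqP ->;
  by move: h; rewrite /split_weight; case: ifP; case: ifP.
Qed.

Lemma pflat_neq0 (F : pflat M) : exists x, x \in val F.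
Proof. by apply/set0Pn; have /and3P[] := valP F. Qed.

(** A proper flat has at most two elements, so it has a positive (negative) total
    weight only when all its elements have weight [1] ([-1]). Hence the members of
    a flag cannot have total weights of both signs, and one of the two linear
    functions [0] and [split_sum] is tight on the whole flag. *)
Lemma split_class_P2 : P2 split_class.
Proof.
apply/P2P => Fl flag.
have [/exists_inP[F FFl Fpos]|/exists_inPn npos] :=
  boolP [exists F in Fl, 0 < split_sum F].
  exists (fun i => (split_weight i)%:~R).
    by rewrite -rmorph_sum !big_ord_recl big_ord0.
  split=> G; rewrite -rmorph_sum -/(split_sum G) /split_class;
    last by rewrite ler_int le_max lexx orbT.
  move=> GFl; congr intr; apply/esym/max_idPr.
  rewrite leNgt; apply/negP => Gneg.
  have [x [xF xG]] : exists x, x \in val F /\ x \in val G.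
    have /orP[/subsetP FG|/subsetP GF] := flag_comparable flag FFl GFl.
      by have [x xF] := pflat_neq0 F; exists x; split=> //; apply: FG.
    by have [x xG] := pflat_neq0 G; exists x; split=> //; apply: GF.
  by have := split_sum_pos Fpos xF; rewrite (split_sum_neg Gneg xG).
exists (fun=> 0); first by rewrite big1.
split=> G; rewrite big1 // ?ler0z /split_class ?le_max ?lexx //.
by move=> /npos; rewrite -leNgt => /max_idPl ->.
Qed.

(** With [a], [b] of weight [-1] and [d], [e] of weight [1], submodularity at
    [[set a; d]] and [[set b; d]] bounds a submodular extension by [-1] at
    [[set a; b; d]], up to the linear function [m]; likewise at [[set a; b; e]].
    But these two sets meet in [[set a; b]] and cover everything, so the two
    values must add up to at least [0]. *)
Lemma split_class_not_P1 (k : closedFieldType) : ~ P1 k split_class.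
Proof.
case/P1_zero_ext=> c /nef_submodular c_sub [m m0 lE].
pose a : 'I_4 := inord 0; pose b : 'I_4 := inord 1.
pose d : 'I_4 := inord 2; pose e : 'I_4 := inord 3.
have extE (F : pflat M) :
    zero_ext c (val F) = split_class F + \sum_(i in val F) m i.
  by rewrite lE subrK.
have ext_line (x y : 'I_4) : x != y ->
    zero_ext c [set x; y] =
      Num.max 0 (split_weight x + split_weight y) + m x + m y.
  move=> xy; have := extE (line E3 x y).
  rewrite /split_class /split_sum /= !sum_set2 //.
  by rewrite addrA.
have ext_point (x : 'I_4) :
    zero_ext c [set x] = Num.max 0 (split_weight x) + m x.
  by have := extE (point E3 x); rewrite /split_class /split_sum /= !big_set1.
have ext_T : zero_ext c [set: 'I_4] = 0.
  by apply: zero_ext_out; rewrite proper_flat_boolean eqxx andbF.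
have neq : [/\ a != b, a != d, b != d, a != e & b != e].
  by split; rewrite -val_eqE /= !inordK.
have [ab ad bd ae be] := neq.
have wE : [/\ split_weight a = -1, split_weight b = -1, split_weight d = 1
    & split_weight e = 1] by rewrite /split_weight !inordK.
have [wa wb wd we] := wE.
have := c_sub [set a; d] [set b; d].
have -> : [set a; d] :&: [set b; d] = [set d].
  rewrite -setUIl; apply/setP=> x; rewrite !inE.
  by case: eqP => // ->; rewrite (negPf ab).
have := c_sub [set a; e] [set b; e].
have -> : [set a; e] :&: [set b; e] = [set e].
  rewrite -setUIl; apply/setP=> x; rewrite !inE.
  by case: eqP => // ->; rewrite (negPf ab).
have := c_sub ([set a; d] :|: [set b; d]) ([set a; e] :|: [set b; e]).
have -> : ([set a; d] :|: [set b; d]) :&: ([set a; e] :|: [set b; e])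
    = [set a; b].
  apply/setP; case=> [[|[|[|[|//]]]] ?]; rewrite !inE -!val_eqE /= !inordK //.
have -> : ([set a; d] :|: [set b; d]) :|: ([set a; e] :|: [set b; e])
    = [set: 'I_4].
  apply/setP; case=> [[|[|[|[|//]]]] ?]; rewrite !inE -!val_eqE /= !inordK //.
rewrite ext_T !ext_line // !ext_point wa wb wd we.
have : m a + m b + m d + m e = 0.
  rewrite -m0 !big_ord_recl big_ord0 addr0 !addrA /a /b /d /e.
  by congr (m _ + m _ + m _ + m _); apply: val_inj; rewrite /= !inordK.
have -> : Num.max 0 (-1 - 1) = 0 :> int by [].
have -> : Num.max 0 1 = 1 :> int by [].
have -> : Num.max 0 (-1 + 1) = 0 :> int by [].
lra.
Qed.
End P2notP1.

(** * A class on the uniform matroid of rank 3 on 5 elements with (P3), not (P2) *)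

Section P3notP2.
Local Notation M := (uniform_matroid 'I_5 3).
Let E3 : (2 < #|'I_5|)%N. Proof. by rewrite card_ord. Qed.

(** The elements form a 5-cycle, with [x] next to [x + 1]; the value at a flat is
    the number of its vertices minus twice the number of its edges. *)
Definition pentagon_class (F : pflat M) : int :=
  \sum_(x in val F) (1 - 2 * (x + 1 \in val F)%:R).

Definition cycle_adj (x y : 'I_5) : int := (x + 1 == y)%:R + (y + 1 == x)%:R.

Lemma pentagon_class_point (F : pflat M) x :
  val F = [set x] -> pentagon_class F = 1.
Proof.
rewrite /pentagon_class => ->; rewrite big_set1 inE.
by case: x => [[|[|[|[|[|//]]]]] ?].
Qed.

Lemma pentagon_class_line (F : pflat M) x y : x != y -> val F = [set x; y] ->
  pentagon_class F = 2 - 2 * cycle_adj x y.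
Proof.
move=> xy; rewrite /pentagon_class => ->; rewrite sum_set2 // !inE /cycle_adj.
have nx (z : 'I_5) : (z + 1 == z) = false.
  by case: z => [[|[|[|[|[|//]]]]] ?].
by rewrite !nx orbF /=; ring.
Qed.

Lemma cycle_adj01 x y : cycle_adj x y = 0 \/ cycle_adj x y = 1.
Proof.
by case: x => [[|[|[|[|[|//]]]]] ?]; case: y => [[|[|[|[|[|//]]]]] ?];
  rewrite /cycle_adj /=; auto.
Qed.

(** A linear minorant [m] tight at the vertex [0] has [m 0 = 1], so that the edges
    at [0] force [m 1 <= -1] and [m 4 <= -1]; the opposite edge, which is not
    comparable with [0], forces [m 2 + m 3 <= 0]. The total is then at most
    [-1], but it should be [0]. *)
Lemma pentagon_class_not_P2 : ~ P2 pentagon_class.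
Proof.
pose c (n : nat) : 'I_5 := inord n.
move/P2P => /(_ _ (is_flag1 (point E3 (c 0%N)))) [m m0 [mE mle]].
have m_line x y : x != y -> m x + m y <= (2 - 2 * cycle_adj x y)%:~R.
  move=> xy; have := mle (line E3 x y); rewrite (pentagon_class_line xy) //=.
  by rewrite sum_set2.
have := mE _ (set11 _).
rewrite (@pentagon_class_point _ (c 0%N)) // big_set1 => mc0.
have sum0 : m (c 0%N) + m (c 1%N) + m (c 2) + m (c 3) + m (c 4) = 0.
  rewrite -m0 !big_ord_recl big_ord0 addr0 !addrA.
  by congr (m _ + m _ + m _ + m _ + m _); apply: val_inj; rewrite /= !inordK.
have edge x y : x != y -> cycle_adj x y = 1 -> m x + m y <= 0.
  by move=> /m_line + xy; rewrite xy.
have e01 : m (c 0%N) + m (c 1%N) <= 0.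
  by apply: edge; rewrite ?/cycle_adj -!val_eqE /= !inordK.
have e04 : m (c 0%N) + m (c 4) <= 0.
  by apply: edge; rewrite ?/cycle_adj -!val_eqE /= !inordK.
have e23 : m (c 2) + m (c 3) <= 0.
  by apply: edge; rewrite ?/cycle_adj -!val_eqE /= !inordK.
lra.
Qed.

Definition local_support (l : pflat M -> int) (Fl : {set pflat M})
    (m : 'I_5 -> int) : Prop :=
  [/\ \sum_i m i = 0,
      forall F : pflat M, F \in Fl -> \sum_(i in val F) m i = l F &
      forall F : pflat M, F \notin Fl -> is_flag (F |: Fl) ->
        \sum_(i in val F) m i <= l F].

Lemma local_support_P3 (l : pflat M -> int) :
  (forall Fl : {set pflat M}, is_flag Fl -> exists m, local_support l Fl m) ->
  P3 l.
Proof.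
move=> H; apply/P3P => Fl /H[m [m0 mE mle]]; exists (fun x => (m x)%:~R).
  by rewrite -rmorph_sum m0.
split=> [F /mE mF|F Fn /(mle F Fn)]; rewrite -rmorph_sum; first by rewrite mF.
by rewrite ler_int.
Qed.

Let flagU (Fl : {set pflat M}) F G : is_flag (G |: Fl) -> F \in Fl ->
  (val G \subset val F) || (val F \subset val G).
Proof.
move=> flagG FFl; apply: flag_comparable flagG _ _;
  by rewrite !inE ?eqxx ?FFl ?orbT.
Qed.

(** For a flag with the line [ab], only [a], [b] and [ab] matter, so all the
    compensating weight can be put on a third element [c]. The vertex that is made
    tight is the one that may belong to the flag. *)
Lemma pentagon_class_P3_line (Fl : {set pflat M}) a b : is_flag Fl -> a != b ->
  line E3 a b \in Fl -> point E3 b \notin Fl ->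
  exists m, local_support pentagon_class Fl m.
Proof.
move=> flag ab LFl bFl.
have /subsetPn[c _ cab] : ~~ ([set: 'I_5] \subset [set a; b]).
  apply/negP => /subset_leq_card; rewrite cardsT card_ord cards2.
  by case: (a != b).
pose l := pentagon_class (line E3 a b).
have lE : l = 2 - 2 * cycle_adj a b by rewrite /l (pentagon_class_line ab).
have mS (S : {set 'I_5}) :
    \sum_(x in S) ((x == a)%:R + (l - 1) * (x == b)%:R - l * (x == c)%:R) =
    (a \in S)%:R + (l - 1) * (b \in S)%:R - l * (c \in S)%:R.
  by rewrite sumrB big_split /= -!mulr_sumr !sum_indicator.
have [ca cb] : (c == a) = false /\ (c == b) = false.
  by move: cab; rewrite !inE => /norP[/negPf -> /negPf ->].
have ba : (b == a) = false by apply: contraNF ab => /eqP ->.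
have tight (G : pflat M) : val G = [set a] \/ val G = [set a; b] ->
    \sum_(x in val G) ((x == a)%:R + (l - 1) * (x == b)%:R - l * (x == c)%:R)
    = pentagon_class G.
  rewrite mS; case=> GE.
    by rewrite (pentagon_class_point GE) GE !inE eqxx ca ba /=; ring.
  rewrite (pentagon_class_line ab GE) -lE GE !inE !eqxx orbT ca cb /=; ring.
exists (fun x => (x == a)%:R + (l - 1) * (x == b)%:R - l * (x == c)%:R).
split=> [|G GFl|G _ flagG].
- transitivity (\sum_(x in [set: 'I_5])
      ((x == a)%:R + (l - 1) * (x == b)%:R - l * (x == c)%:R)).
    by apply: eq_bigl => x; rewrite inE.
  by rewrite mS !inE; ring.
- apply: tight.
  have [GE|GE|GE] := comparable_line E3 ab (flag_comparable flag GFl LFl).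
  + by left.
  + by case/negP: bFl; rewrite -(val_inj (GE : val G = val (point E3 b))).
  + by right.
have [GE|GE|GE] := comparable_line E3 ab (flagU flagG LFl).
- by rewrite tight //; left.
- rewrite mS (pentagon_class_point GE) GE !inE eqxx (negPf ab) cb lE.
  by have [->|->] := cycle_adj01 a b.
- by rewrite tight //; right.
Qed.

(** For the flag of the vertex [p], only the lines through [p] matter: they allow
    the value [-1] at the two neighbours of [p] and [1] at the two others; it is
    lowered to [0] at one of the latter, [p + 2], to make the sum zero. *)
Lemma pentagon_class_P3_point (Fl : {set pflat M}) p :
  is_flag Fl -> point E3 p \in Fl ->
  (forall F, F \in Fl -> val F = [set p]) ->
  exists m, local_support pentagon_class Fl m.
Proof.
move=> flag pFl Flp.
pose m x : int := if x == p then 1 else 1 - 2 * cycle_adj p x - (x == p + 2)%:R.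
have m_p : m p = 1 by rewrite /m eqxx.
exists m; split=> [|G /Flp GE|G _ flagG].
- rewrite /m /cycle_adj !big_ord_recl big_ord0; case: p {pFl Flp m m_p} => p' hp.
  by case: p' hp => [|[|[|[|[|//]]]]] hp.
- by rewrite (pentagon_class_point GE) GE big_set1.
have [GE|[y py GE]] := comparable_point E3 (flagU flagG pFl).
  by rewrite (pentagon_class_point GE) GE big_set1 m_p.
rewrite (pentagon_class_line py GE) GE sum_set2 // m_p /m eq_sym (negPf py).
by case: (y == p + 2); lia.
Qed.

Lemma pentagon_class_P3 : P3 pentagon_class.
Proof.
apply: local_support_P3 => Fl flag.
have [/existsP[a /existsP[b /and3P[ab LFl bFl]]]|noline] :=
  boolP [exists a, exists b,
           [&& a != b, line E3 a b \in Fl & point E3 b \notin Fl]].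
  exact: pentagon_class_P3_line LFl bFl.
have no_line a b F :
    a != b -> val F = [set a; b] -> F \in Fl -> point E3 b \in Fl.
  move=> ab FE FFl; apply: contraNT noline => bFl.
  apply/existsP; exists a; apply/existsP; exists b; rewrite ab bFl andbT /=.
  by rewrite -(val_inj (FE : val F = val (line E3 a b))).
have [/existsP[p pFl]|nopoint] := boolP [exists p, point E3 p \in Fl].
  apply: (pentagon_class_P3_point flag pFl) => F FFl.
  have [//|[y py FE]] := comparable_point E3 (flag_comparable flag FFl pFl).
  have := flag_comparable flag pFl (no_line _ _ _ py FE FFl).
  by rewrite !sub1set !inE eq_sym orbb eq_sym (negPf py).
have Fl0 F : F \notin Fl.
  apply/negP => FFl; case/negP: nopoint; apply/existsP.
  case: (pflat_uniform3P E3 F) => [x FE|x y xy FE].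
    by exists x; rewrite -(val_inj (FE : val F = val (point E3 x))).
  by exists y; apply: no_line xy FE FFl.
exists (fun=> 0); split=> [|F|F _ _]; first by rewrite big1.
  by rewrite (negPf (Fl0 F)).
rewrite big1 //.
case: (pflat_uniform3P E3 F) => [x FE|x y xy FE].
  by rewrite (pentagon_class_point FE).
by rewrite (pentagon_class_line xy FE); have [->|->] := cycle_adj01 x y.
Qed.
End P3notP2.

Theorem theorem5p1 (k : closedFieldType) :
  (forall (E : finType) (M : matroid E) (l : pflat M -> int),
     loopless M -> (P1 k l -> P2 l) /\ (P2 l -> P3 l)) /\
  ~ (forall (E : finType) (M : matroid E) (l : pflat M -> int),
       loopless M -> P2 l -> P1 k l) /\
  ~ (forall (E : finType) (M : matroid E) (l : pflat M -> int),
       loopless M -> P3 l -> P2 l).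
Proof.
split; [|split].
- by move=> E M l _; split; [apply: P1_P2 | apply: P2_P3].
- move=> P2_P1; apply: (@split_class_not_P1 k).
  exact: P2_P1 (@loopless_uniform _ 3 isT) split_class_P2.
- move=> P3_P2; apply: pentagon_class_not_P2.
  exact: P3_P2 (@loopless_uniform _ 3 isT) pentagon_class_P3.
Qed.
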